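(* For any universal Turing machine $U$ there exists a constant $c_U\in\mathbb{N}$ such that \[ I(\bar{\sigma}\mid\mathcal{M}_{\mathbb{N}})\le 6K_U(\sigma)+c_U \] for every binary string $\sigma$.
   Context: Notation: $\mathbf{1}=\{0\}$, $\mathbf{2}=\{0,1\}$, $\mathbb{N}=\{0,1,2,\dots\}$; $\mathbf{2}^X$ is the power set of $X$. For $x\in X$ the same letter denotes the constant map $\mathbf{1}\to X$, $0\mapsto x$. For a map $f:X\to Y$, $f$ also denotes the direct-image map $\mathbf{2}^X\to\mathbf{2}^Y$, and $f^{-1}:\mathbf{2}^Y\to\mathbf{2}^X$ the preimage map. Diagrams: a diagram is a triple $(\mathcal{S},\mathcal{S}',\mathcal{M})$ where $\mathcal{S}$ is an indexed family of sets (members with distinct indices are treated as distinct), $\mathcal{S}'$ a subfamily, and $\mathcal{M}$ an indexed family of maps $\varphi:\mathbf{2}^{\mathrm{dm}(\varphi)}\to\mathbf{2}^{\mathrm{cdm}(\varphi)}$ with $\mathrm{dm}(\varphi),\mathrm{cdm}(\varphi)\in\mathcal{S}$. For $T\in\mathcal{S}$ let $\mathrm{in}(T)=\{\varphi:\mathrm{cdm}(\varphi)=T\}$. A cross section assigns to each $X\in\mathcal{S}$ a subset $s(X)\subseteq X$ such that whenever $\mathrm{in}(X)\ne\emptyset$: $s(X)=\bigcap_{\varphi\in\mathrm{in}(X)}\varphi(s(\mathrm{dm}(\varphi)))$ if $X\notin\mathcal{S}'$ and $s(X)=\bigcup_{\varphi\in\mathrm{in}(X)}\varphi(s(\mathrm{dm}(\varphi)))$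 if $X\in\mathcal{S}'$. For a diagram containing a member $\mathbf{1}$, let $\Gamma(\mathcal{S},\mathcal{S}',\mathcal{M}\mid s_{\mathbf{1}})$ be the set of cross sections with $s(\mathbf{1})=\mathbf{1}$. The data $(\mathcal{S},\mathcal{S}',\mathcal{M},\{\mathbf{1}\},s_{\mathbf{1}},X)$ represents $A\subseteq X$ (with $X\in\mathcal{S}$) if $s(X)=A$ for every $s\in\Gamma(\mathcal{S},\mathcal{S}',\mathcal{M}\mid s_{\mathbf{1}})$. Generated maps and sizes: for a set $\mathcal{M}_{\mathrm{S}}$ of maps, $\langle\mathcal{M}_{\mathrm{S}}\rangle$ is the smallest class containing $\mathcal{M}_{\mathrm{S}}$, all identity maps, all maps $\omega:X\to\mathbf{1}$ and all projections of finite Cartesian products onto a factor, closed under composition and under product maps $f_1\times\cdots\times f_n:x\mapsto(f_1(x),\dots,f_n(x))$. The size $|f|_{\mathcal{M}_{\mathrm{S}}}$ of $f\in\langle\mathcal{M}_{\mathrm{S}}\rangle$ is $1$ if $f$ is in $\mathcal{M}_{\mathrm{S}}$, an identity, some $\omega$, or a projection; otherwise it is $1$ plus the minimum, over all ways of writing $f=g\circ h$ or $f=f_1\times\cdots\times f_n$ with components in $\langle\mathcal{M}_{\mathrm{S}}\rangle$, of the sum of the sizes of the components. A diagram is generated by $\mathcal{M}_{\mathrm{S}}$ if every map in $\mathcal{M}$ is the direct-image map $f$ or the preimage map $f^{-1}$ of some $f\in\langle\mathcal{M}_{\mathrm{S}}\rangle$; the size of such a diagram map is $|f|_{\mathcal{M}_{\mathrm{S}}}$.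 The structural information $I(A\mid\mathcal{M}_{\mathrm{S}})$ of $A\subseteq X$ is the minimum of $\sum_{\varphi\in\mathcal{M}}|\varphi|_{\mathcal{M}_{\mathrm{S}}}$ over all data $(\mathcal{S},\mathcal{S}',\mathcal{M},\{\mathbf{1}\},s_{\mathbf{1}},X)$ representing $A$ with $(\mathcal{S},\mathcal{S}',\mathcal{M})$ generated by $\mathcal{M}_{\mathrm{S}}$; it is $\infty$ if no such data gives a finite sum. $\mathcal{M}_{\mathbb{N}}=\{0,\mathrm{succ}\}$ where $0:\mathbf{1}\to\mathbb{N}$ is the constant map and $\mathrm{succ}(n)=n+1$. Strings: a binary string $\sigma$ with symbols $\sigma[0],\dots,\sigma[|\sigma|-1]\in\{0,1\}$ is encoded as $\bar{\sigma}=\{(i,\sigma[i]):0\le i\le|\sigma|-1\}\cup\{(|\sigma|,0),(|\sigma|,1)\}\subseteq\mathbb{N}\times\mathbb{N}$. For a universal Turing machine $U$ (binary input alphabet), $U(p)=\sigma$ means $U$ on input $p$ accepts leaving $\sigma$ on its tape, and the Kolmogorov complexity is $K_U(\sigma)=\min\{|p|:p\in\{0,1\}^*,\ U(p)=\sigma\}$. *)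

(* Defs.v *)
From HB Require Import structures.
From mathcomp Require Import all_boot.
From mathcomp Require Import boolp classical_sets.

Set Implicit Arguments.
Unset Strict Implicit.
Unset Printing Implicit Defensive.

Local Open Scope classical_set_scope.

(** Values in N together with infinity are encoded as [option nat], [None]
    standing for infinity. *)

Definition min_nat (P : set nat) : option nat :=
  if pselect (exists n, `[< P n >]) is left h then Some (ex_minn h) else None.

Definition le_inf (x y : option nat) : Prop :=
  match x, y with
  | _, None => True
  | None, Some _ => False
  | Some m, Some n => m <= n
  end.

(** Sets are types, the set {0} is [unit], and the finite Cartesian product of
    [T 0, ..., T n] is [forall i : 'I_n.+1, T i].  In particular N x N is
    ['I_2 -> nat]. *)

Definition map_class := forall X Y : Type, (X -> Y) -> Prop.

Inductive basic_map (M : map_class) : forall X Y : Type, (X -> Y) -> Prop :=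
| basic_mem X Y (f : X -> Y) : M X Y f -> basic_map M f
| basic_id X : basic_map M (fun x : X => x)
| basic_omega X : basic_map M (fun _ : X => tt)
| basic_proj n (T : 'I_n.+1 -> Type) (i : 'I_n.+1) :
    basic_map M (fun x : forall j, T j => x i).

Definition prod_map n X (T : 'I_n.+1 -> Type) (f : forall i, X -> T i) :
    X -> forall i, T i :=
  fun x i => f i x.

(** [expr_size M f k]: some expression building [f] from basic maps by
    compositions and products has exactly [k] nodes.  Such a [k] exists if and
    only if [f] belongs to the class generated by [M]. *)
Inductive expr_size (M : map_class) :
    forall X Y : Type, (X -> Y) -> nat -> Prop :=
| expr_basic X Y (f : X -> Y) : basic_map M f -> expr_size M f 1
| expr_comp X Y Z (g : Y -> Z) (h : X -> Y) a b :
    expr_size M g a -> expr_size M h b -> expr_size M (g \o h) (a + b).+1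
| expr_prod n X (T : 'I_n.+1 -> Type) (f : forall i, X -> T i)
    (a : 'I_n.+1 -> nat) :
    (forall i, expr_size M (f i) (a i)) ->
    expr_size M (prod_map f) (\sum_i a i).+1.

(** The size of a map; [None] if it is not generated by [M].  The recursive
    description of the size, as 1 plus a minimum of sums of sizes of components,
    is [size_equation] below; [map_size] is its unique solution. *)
Definition map_size (M : map_class) (X Y : Type) (f : X -> Y) : option nat :=
  min_nat [set k | expr_size M f k].

Inductive component_sum (sz : forall X Y : Type, (X -> Y) -> option nat) :
    forall X Y : Type, (X -> Y) -> nat -> Prop :=
| sum_comp X Y Z (g : Y -> Z) (h : X -> Y) a b :
    sz Y Z g = Some a -> sz X Y h = Some b ->
    component_sum sz (g \o h) (a + b)
| sum_prod n X (T : 'I_n.+1 -> Type) (f : forall i, X -> T i)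
    (a : 'I_n.+1 -> nat) :
    (forall i, sz X (T i) (f i) = Some (a i)) ->
    component_sum sz (prod_map f) (\sum_i a i).

Lemma min_natP (P : set nat) n :
  min_nat P = Some n <-> P n /\ forall k, P k -> n <= k.
Proof.
rewrite /min_nat; case: pselect => [h|nh]; last first.
  by split=> // -[Pn _]; case: nh; exists n; apply/asboolP.
case: ex_minnP => m /asboolP Pm mmin; split=> [[<-]|[Pn nmin]].
  by split=> // k Pk; apply: mmin; apply/asboolP.
congr Some; apply/eqP; rewrite eqn_leq nmin // andbT.
by apply: mmin; apply/asboolP.
Qed.

Lemma min_natN (P : set nat) : min_nat P = None <-> forall n, ~ P n.
Proof.
rewrite /min_nat; case: pselect => [h|nh]; split=> //.
- by move=> nP; exfalso; case: h => n /asboolP /nP.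
- by move=> _ n Pn; apply: nh; exists n; apply/asboolP.
Qed.

Lemma min_nat_le (P : set nat) k :
  P k -> exists2 n, min_nat P = Some n & n <= k.
Proof.
case E : (min_nat P) => [n|] Pk; last by move/min_natN: E => /(_ _ Pk).
by exists n => //; move/min_natP: E => [_]; apply.
Qed.

Lemma expr_size_gt0 M X Y (f : X -> Y) k : expr_size M f k -> 0 < k.
Proof. by case. Qed.

Lemma expr_size_case M X Y (f : X -> Y) k : expr_size M f k ->
  basic_map M f \/
  exists2 m, component_sum (@map_size M) f m & m < k.
Proof.
case=> {X Y f k}; first by left.
- move=> X Y Z g h a b ga hb; right.
  have [a' ea la] := min_nat_le (P := [set k | expr_size M g k]) ga.
  have [b' eb lb] := min_nat_le (P := [set k | expr_size M h k]) hb.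
  by exists (a' + b'); [exact: sum_comp | rewrite ltnS leq_add].
- move=> n X T f a fa; right.
  have /choice[a' ea] : forall i, exists m,
      map_size M (f i) = Some m /\ m <= a i.
    move=> i; have [m em lm] :=
      min_nat_le (P := [set k | expr_size M (f i) k]) (fa i).
    by exists m.
  exists (\sum_i a' i); first by apply: sum_prod => i; case: (ea i).
  by rewrite ltnS; apply: leq_sum => i _; case: (ea i).
Qed.

Lemma component_sum_expr M X Y (f : X -> Y) m :
  component_sum (@map_size M) f m -> expr_size M f m.+1.
Proof.
case=> {X Y f m}.
- move=> X Y Z g h a b /min_natP[ga _] /min_natP[hb _]; exact: expr_comp.
- by move=> n X T f a fa; apply: expr_prod => i; case/min_natP: (fa i).
Qed.

Definition size_equation (M : map_class)
    (sz : forall X Y : Type, (X -> Y) -> option nat) : Prop :=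
  forall (X Y : Type) (f : X -> Y),
    (basic_map M f -> sz X Y f = Some 1) /\
    (~ basic_map M f ->
       sz X Y f = omap succn (min_nat [set k | component_sum sz f k])).

Lemma map_sizeE M : size_equation M (@map_size M).
Proof.
move=> X Y f.
split=> [bf|nbf].
  apply/min_natP; split; first exact: expr_basic.
  by move=> k /expr_size_gt0.
case E : (min_nat [set k | component_sum _ _ _]) => [m|] /=.
  case/min_natP: E => cm mmin; apply/min_natP; split.
    exact: component_sum_expr.
  by move=> k /expr_size_case[//|[j /mmin]]; exact: leq_ltn_trans.
move/min_natN: E => nc; apply/min_natN => k /expr_size_case[//|[j cj _]].
exact: nc cj.
Qed.

Lemma size_equation_unique M sz : size_equation M sz ->
  forall X Y (f : X -> Y), sz X Y f = map_size M f.
Proof.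
move=> szE.
have sz_expr k : forall X Y (f : X -> Y), sz X Y f = Some k -> expr_size M f k.
  elim/ltn_ind: k => k IH X Y f; case: (pselect (basic_map M f)) => bf.
    by rewrite (szE X Y f).1 // => -[<-]; exact: expr_basic.
  rewrite (szE X Y f).2 //.
  case E : (min_nat _) => [m|] //= -[km]; move: E; rewrite -km =>
    /min_natP[/= cm _].
  move: km IH; case: cm => {X Y f bf m}.
  - move=> X Y Z g h a b ga hb km IH.
    by apply: expr_comp; apply: IH => //; rewrite -km ltnS ?leq_addr ?leq_addl.
  - move=> n X T f a fa km IH; apply: expr_prod => i; apply: IH => //.
    by rewrite -km ltnS (bigD1 i) //= leq_addr.
have expr_sz X Y (f : X -> Y) k :
    expr_size M f k -> exists2 j, sz X Y f = Some j & j <= k.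
  have sum_sz X' Y' (f' : X' -> Y') m : component_sum sz f' m ->
      exists2 j, sz X' Y' f' = Some j & j <= m.+1.
    move=> cm; case: (pselect (basic_map M f')) => bf.
      by rewrite (szE X' Y' f').1 //; exists 1.
    rewrite (szE X' Y' f').2 //.
    have [j -> jm] := min_nat_le (P := [set k | component_sum sz f' k]) cm.
    by exists j.+1.
  elim=> {X Y f k}.
  - by move=> X Y f bf; rewrite (szE X Y f).1 //; exists 1.
  - move=> X Y Z g h a b _ [a' ea la] _ [b' eb lb].
    have [j ej lj] := sum_sz _ _ _ _ (sum_comp ea eb).
    by exists j => //; rewrite (leq_trans lj) // ltnS leq_add.
  - move=> n X T f a _ fa.
    have /choice[a' ea] : forall i,
        exists m, sz X (T i) (f i) = Some m /\ m <= a i.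
      by move=> i; have [m em lm] := fa i; exists m.
    have [j ej lj] := sum_sz _ _ _ _ (sum_prod (fun i => (ea i).1)).
    exists j => //; rewrite (leq_trans lj) // ltnS.
    by apply: leq_sum => i _; case: (ea i).
move=> X Y f; case E : (map_size M f) => [k|].
  case/min_natP: E => fk kmin; have [j ej jk] := expr_sz _ _ _ _ fk.
  rewrite ej; congr Some; apply/eqP; rewrite eqn_leq jk /=.
  exact/kmin/sz_expr.
case E' : (sz X Y f) => [k|] //.
by move/min_natN: E => /(_ k) []; exact: sz_expr.
Qed.

(** The indexed families: [member] indexes the sets, [arrow X Y] indexes the
    maps with domain index [X] and codomain index [Y]. *)
Record diagram := Diagram {
  member : Type;
  carrier : member -> Type;
  union_member : set member;
  arrow : member -> member -> Type;
  action : forall X Y : member,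
    arrow X Y -> set (carrier X) -> set (carrier Y)
}.

Definition incoming (D : diagram) (Y : member D) : Type :=
  {X : member D & arrow X Y}.

Definition incoming_value (D : diagram) (s : forall X, set (carrier X))
    (Y : member D) (a : incoming Y) : set (carrier Y) :=
  action (projT2 a) (s (projT1 a)).

Definition cross_section (D : diagram)
    (s : forall X : member D, set (carrier X)) : Prop :=
  forall Y : member D, inhabited (incoming Y) ->
    (~ union_member Y -> s Y = \bigcap_(a : incoming Y) incoming_value s a) /\
    (union_member Y -> s Y = \bigcup_(a : incoming Y) incoming_value s a).

Definition pointed_sections (D : diagram) (one : member D) :
    set (forall X : member D, set (carrier X)) :=
  [set s | cross_section s /\ s one = [set: carrier one]].

(** The equality of dependent pairs says that [carrier x] is [X] and that [s x],
    seen as a subset of [X], is [A].  Nonemptiness excludes inconsistent data: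
    for instance, an arrow into [one] whose value is forced to be empty leaves no
    section at all, and would represent every subset of every set. *)
Definition represents (D : diagram) (one x : member D) (X : Type) (A : set X) :
    Prop :=
  [/\ carrier one = unit,
      pointed_sections one !=set0 &
      forall s, pointed_sections one s ->
        existT (fun T => set T) (carrier x) (s x) = existT _ X A].

(** [action_size M phi k]: [phi] is the image or preimage map of a generated map
    of size [k]. *)
Definition action_size (M : map_class) (X Y : Type) (phi : set X -> set Y)
    (k : nat) : Prop :=
  (exists f : X -> Y,
     phi = (fun B => [set f x | x in B]) /\ map_size M f = Some k) \/
  (exists f : Y -> X,
     phi = (fun B => f @^-1` B) /\ map_size M f = Some k).

Definition arrows (D : diagram) : Type :=
  {X : member D & {Y : member D & arrow X Y}}.

(** [D] is generated by [M] and the sum of the sizes of its maps is the finite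
    number [k].  As sizes are positive, a finite sum has finitely many terms. *)
Definition diagram_size (M : map_class) (D : diagram) (k : nat) : Prop :=
  exists n (e : 'I_n -> arrows D) (w : 'I_n -> nat),
    [/\ bijective e,
        forall i, action_size M (action (projT2 (projT2 (e i)))) (w i) &
        k = \sum_i w i].

Definition structural_information (M : map_class) (X : Type) (A : set X) :
    option nat :=
  min_nat [set k | exists (D : diagram) (one x : member D),
    represents one x A /\ diagram_size M D k].

Inductive nat_maps : map_class :=
| nat_maps_zero : nat_maps (fun _ : unit => 0)
| nat_maps_succ : nat_maps succn.

Definition pt (m n : nat) : 'I_2 -> nat := fun i => if i == ord0 then m else n.

Definition string_set (sigma : seq bool) : set ('I_2 -> nat) :=
  [set pt i (nth false sigma i) | i in [set i | i < size sigma]] `|`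
  [set pt (size sigma) 0; pt (size sigma) 1].

(** Deterministic single-tape machines with a one-way infinite tape.  The values
    of [tm_trans] on the two halting states are irrelevant, and the boolean it
    returns tells whether the head moves right; a left move on cell 0 leaves the
    head there. *)
Record turing_machine := TuringMachine {
  tm_state : finType;
  tm_symbol : finType;
  tm_blank : tm_symbol;
  tm_bit : bool -> tm_symbol;
  tm_bit_inj : injective tm_bit;
  tm_bit_blank : forall b, tm_bit b != tm_blank;
  tm_start : tm_state;
  tm_accept : tm_state;
  tm_reject : tm_state;
  tm_accept_reject : tm_accept != tm_reject;
  tm_trans : tm_state -> tm_symbol -> tm_state * tm_symbol * bool
}.

Record tm_config (U : turing_machine) := TMConfig {
  tm_control : tm_state U;
  tm_head : nat;
  tm_tape : nat -> tm_symbol U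
}.

Definition tm_string_tape (U : turing_machine) (w : seq bool) :
    nat -> tm_symbol U :=
  fun i => nth (tm_blank U) (map (tm_bit U) w) i.

Definition tm_init (U : turing_machine) (p : seq bool) : tm_config U :=
  TMConfig (tm_start U) 0 (tm_string_tape U p).

Definition tm_step (U : turing_machine) (c : tm_config U) : tm_config U :=
  let: TMConfig q h t := c in
  if (q == tm_accept U) || (q == tm_reject U) then c else
  let: (q', a, to_right) := tm_trans q (t h) in
  TMConfig q' (if to_right then h.+1 else h.-1)
    (fun i => if i == h then a else t i).

(** [U] on input [p] accepts with tape content [sigma] followed by blanks. *)
Definition tm_outputs (U : turing_machine) (p sigma : seq bool) : Prop :=
  exists n, let c := iter n (@tm_step U) (tm_init U p) in
    tm_control c = tm_accept U /\ tm_tape c =1 tm_string_tape U sigma.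

Definition tm_computable (f : seq bool -> seq bool) : Prop :=
  exists E : turing_machine, forall w, tm_outputs E w (f w).

(** [enc M w] is the encoding of the pair of [M] and [w].  Computability in [w]
    for each [M] suffices: translating first into the inputs of a fixed machine
    that simulates all others from effective descriptions yields an encoding
    which is also effective in [M]. *)
Definition universal (U : turing_machine) : Prop :=
  exists enc : turing_machine -> seq bool -> seq bool,
    (forall M, tm_computable (enc M)) /\
    (forall M w sigma, tm_outputs U (enc M w) sigma <-> tm_outputs M w sigma).

Definition kolmogorov (U : turing_machine) (sigma : seq bool) : option nat :=
  min_nat [set k | exists p : seq bool, size p = k /\ tm_outputs U p sigma].

(* Main.v *)
(** A computation of [U] is a one-dimensional cellular automaton: put the head
    state into the cell it visits and add a border cell on the left; then the
    content of cell [j + 1] at time [t + 1] is a function of the contents of cells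
    [j], [j + 1], [j + 2] at time [t].  In a diagram whose sets are copies of
    N x N, read as space-time [(t, j)], let [Cell s] collect the points with
    content [s]; the transition rule becomes a finite system of equations between
    these sets, and projecting the rows in which [U] accepts gives the encoding of
    the output.  Only the first row depends on the input: moving a marker one cell
    to the right costs 5 and adding it to a set [Cell s] costs 1, hence 6 per
    symbol.

    Cross sections are arbitrary, not least, fixed points.  Uniqueness holds because
    every equation refers to points that are smaller for a well-founded measure
    (essentially the time). *)
Require Import Defs.
From mathcomp Require Import all_boot.
From mathcomp Require Import boolp classical_sets.

Set Implicit Arguments.
Unset Strict Implicit.
Unset Printing Implicit Defensive.

Local Open Scope classical_set_scope.

Local Notation point := ('I_2 -> nat).

(** * Sizes of maps into N x N built from pairing, successor and zero *)

Lemma pt_fst m n : pt m n ord0 = m.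
Proof. by []. Qed.

Lemma pt_snd m n : pt m n ord_max = n.
Proof. by []. Qed.

Lemma pt_eta (z : point) : pt (z ord0) (z ord_max) = z.
Proof.
apply: funext => i; rewrite /pt; case: eqP => [-> //|/eqP i0].
by congr z; apply: val_inj; case: i i0 => [[|[|]]].
Qed.

Lemma expr_pair M X (g h : X -> nat) a b :
  expr_size M g a -> expr_size M h b ->
  expr_size M (fun x => pt (g x) (h x)) (a + b).+1.
Proof.
move=> ga hb.
have := @expr_prod M 1 X (fun _ => nat) (fun i => if i == ord0 then g else h)
  (fun i => if i == ord0 then a else b).
rewrite !big_ord_recl big_ord0 addn0 /=.
have -> : prod_map (fun i : 'I_2 => if i == ord0 then g else h) =
          (fun x => pt (g x) (h x)).
  by apply: funext => x; apply: funext => i; rewrite /prod_map /pt; case: eqP.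
by apply=> i; case: eqP.
Qed.

Lemma expr_coord M (i : 'I_2) : expr_size M (fun z : point => z i) 1.
Proof. exact/expr_basic/(@basic_proj M 1 (fun _ => nat)). Qed.

Lemma expr_id M X : expr_size M (fun x : X => x) 1.
Proof. exact/expr_basic/basic_id. Qed.

Lemma expr_succ X (g : X -> nat) a :
  expr_size nat_maps g a -> expr_size nat_maps (fun x => (g x).+1) a.+2.
Proof.
move=> ga; rewrite -[a.+2]/(1 + a).+1.
by apply: (expr_comp (g := succn)) => //; exact/expr_basic/basic_mem/nat_maps_succ.
Qed.

Lemma expr_zero X : expr_size nat_maps (fun _ : X => 0) 3.
Proof.
apply: (@expr_comp _ _ _ _ (fun _ : unit => 0) (fun _ : X => tt) 1 1).
  exact/expr_basic/basic_mem/nat_maps_zero.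
exact/expr_basic/basic_omega.
Qed.

(** * Direct images and preimages, treated uniformly *)

Inductive link (X Y : Type) := Image of (X -> Y) | Preimage of (Y -> X).

Definition link_act X Y (l : link X Y) : set X -> set Y :=
  match l with
  | Image f => fun B => [set f x | x in B]
  | Preimage f => fun B => f @^-1` B
  end.

(** Both kinds of maps carry points along a relation; in this form one dependency argument covers
    images and preimages alike. *)
Definition link_rel X Y (l : link X Y) (x : X) (y : Y) : Prop :=
  match l with Image f => f x = y | Preimage f => x = f y end.

Lemma link_actE X Y (l : link X Y) B y :
  link_act l B y <-> exists2 x, B x & link_rel l x y.
Proof.
by case: l => f //=; split=> [Bx|[x Bx <-//]]; exists (f y).
Qed.

Definition link_expr M X Y (l : link X Y) (k : nat) : Prop :=
  match l with
  | Image f => exists2 m, expr_size M f m & m <= k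
  | Preimage f => exists2 m, expr_size M f m & m <= k
  end.

Lemma link_action_size M X Y (l : link X Y) k : link_expr M l k ->
  exists2 m, action_size M (link_act l) m & m <= k.
Proof.
case: l => f /= [j /(min_nat_le (P := [set k | expr_size M f k]))[m fm mj] jk].
  by exists m; [left; exists f | exact: leq_trans jk].
by exists m; [right; exists f | exact: leq_trans jk].
Qed.

(** * Finite systems of set equations as diagrams *)

Section System.

Variables (W A : Type).

(* The index [None] is that of the distinguished set {0}. *)
Definition car (v : option W) : Type := if v is Some _ then point else unit.

Variables (um : pred W) (src : A -> option W) (dst : A -> W).
Variable lnk : forall a : A, link (car (src a)) point.

Local Notation family := (forall v, set (car v)).

Definition rhs (s : family) (w : W) : set point :=
  if um w then [set y | exists a, dst a = w /\ link_act (lnk a) (s (src a)) y]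
  else [set y | forall a, dst a = w -> link_act (lnk a) (s (src a)) y].

(** Cross sections leave a set without incoming maps arbitrary, so uniqueness can only concern the
    other sets and {0}, whose value is prescribed. *)
Definition constrained (v : option W) : Prop :=
  if v is Some w then exists a, dst a = w else True.

Definition solution (s : family) : Prop :=
  s None = setT /\ forall w, constrained (Some w) -> s (Some w) = rhs s w.

(* A single natural number would not do: through a projection, one point may
   depend on points of unboundedly large level. *)
Lemma solution_unique (stage : option W -> nat) (level : forall v, car v -> nat)
    (s s' : family) :
  (forall a, constrained (src a)) ->
  (forall a x y, link_rel (lnk a) x y ->
     stage (src a) < stage (Some (dst a)) \/
     stage (src a) = stage (Some (dst a)) /\
     level (src a) x < level (Some (dst a)) y) ->
  solution s -> solution s' -> forall v, constrained v -> s v = s' v.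
Proof.
move=> srcP decr [s0 sE] [s0' sE'].
suff H n m v : stage v = n -> forall x, level v x = m -> constrained v ->
    s v x <-> s' v x.
  by move=> v cv; apply/predeqP => x; exact: (H _ _ _ (erefl _) _ (erefl _)).
(* Lexicographic induction, first on the stage, then on the level. *)
elim/ltn_ind: n m v => n IHn; elim/ltn_ind=> m IHm [w|] vn; last first.
  by move=> x _ _; rewrite s0 s0'.
move=> y ym cw; rewrite sE // sE' // /rhs.
have H a : dst a = w -> link_act (lnk a) (s (src a)) y <->
    link_act (lnk a) (s' (src a)) y.
  move=> aw; rewrite !link_actE.
  have Hx x : link_rel (lnk a) x y -> s (src a) x <-> s' (src a) x.
    move=> /decr; rewrite aw vn.
    case=> [lt|[e]]; first exact: (IHn _ lt _ _ (erefl _) _ (erefl _)).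
    by rewrite ym => /IHm; exact.
  by split=> -[x sx xy]; exists x => //; apply/(Hx x xy).
case: ifP => _ /=; split.
- by case=> a [aw /H]; exists a; auto.
- by case=> a [aw /H]; exists a; auto.
- by move=> h a aw; apply/H => //; exact: h.
- by move=> h a aw; apply/H => //; exact: h.
Qed.

Variables (n : nat) (f : 'I_n -> A).
Hypothesis f_surj : forall a, exists i, f i = a.

(** There is one arrow for each [i]; repeated values of [f] give parallel arrows, harmless in unions
    and intersections. *)
Inductive arrow_of : option W -> option W -> Type :=
  Arrow i : arrow_of (src (f i)) (Some (dst (f i))).

Definition system_action X Y (a : arrow_of X Y) : set (car X) -> set (car Y) :=
  match a with Arrow i => link_act (lnk (f i)) end.

Definition system_diagram : diagram :=
  @Diagram (option W) car [set v | if v is Some w then um w else false]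
    arrow_of system_action.

Definition incoming_arrow i : @incoming system_diagram (Some (dst (f i))) :=
  existT _ (src (f i)) (Arrow i).

(** Stated for a variable [v] so that case analysis on [Arrow] goes through; at [None] it says that
    {0} has no incoming arrow. *)
Lemma incoming_inv (s : family) v (b : @incoming system_diagram v) :
  match v return @incoming system_diagram v -> Prop with
  | Some w => fun b => exists2 a, dst a = w &
      @incoming_value system_diagram s (Some w) b = link_act (lnk a) (s (src a))
  | None => fun _ => False
  end b.
Proof. by case: b => X b; case: b => i; exists (f i). Qed.

Lemma incomingP (s : family) (w : W) (b : @incoming system_diagram (Some w)) :
  exists2 a, dst a = w &
    @incoming_value system_diagram s (Some w) b = link_act (lnk a) (s (src a)).
Proof. exact: (incoming_inv s b). Qed.

Lemma incoming_onto (s : family) a0 :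
  exists a : @incoming system_diagram (Some (dst a0)),
    @incoming_value system_diagram s _ a = link_act (lnk a0) (s (src a0)).
Proof. by have [i <-] := f_surj a0; exists (incoming_arrow i). Qed.

Lemma pointed_sectionsE (s : family) :
  @pointed_sections system_diagram None s <-> solution s.
Proof.
split=> [[cs s1]|[s1 sE]]; split=> //.
- move=> w [a0 a0w].
  have inc : inhabited (@incoming system_diagram (Some w)).
    by rewrite -a0w; have [b _] := incoming_onto s a0; exists.
  have [csI csU] := cs (Some w) inc; rewrite /rhs.
  case: ifP => uw.
  + rewrite csU //; apply/predeqP => y; split.
      by case=> b _ bv; have [a aw e] := incomingP s b; exists a; rewrite -e.
    case=> a [aw]; rewrite -aw; have [b <-] := incoming_onto s a.
    by exists b.
  + rewrite csI /= ?uw //; apply/predeqP => y; split.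
      move=> h a aw; move: y h; rewrite -aw => y h.
      by have [b <-] := incoming_onto s a; exact: h.
    by move=> h b _; have [a aw e] := incomingP s b; move: (h a aw); rewrite -e.
- case=> [w|]; last by case=> b; case: (incoming_inv s b).
  move=> [inc]; have [a0 a0w _] := incomingP s inc.
  have {}sE : s (Some w) = rhs s w by apply: sE; exists a0.
  split=> /= uw; rewrite sE /rhs; first move/negP/negbTE: uw => uw; rewrite uw.
  + apply/predeqP => y; split.
      by move=> h b _; have [a aw e] := incomingP s b; move: (h a aw); rewrite -e.
    move=> h a aw; move: y h; rewrite -aw => y h.
    by have [b <-] := incoming_onto s a; exact: h.
  + apply/predeqP => y; split.
      case=> a [aw]; rewrite -aw; have [b <-] := incoming_onto s a.
      by exists b.
    by case=> b _ bv; have [a aw e] := incomingP s b; exists a; rewrite -e.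
Qed.

Lemma system_diagram_size M (wt : A -> nat) :
  (forall a, link_expr M (lnk a) (wt a)) ->
  exists2 k, diagram_size M system_diagram k & k <= \sum_i wt (f i).
Proof.
move=> wtP.
have /choice[w wP] i : exists m,
    action_size M (link_act (lnk (f i))) m /\ m <= wt (f i).
  by have [m] := link_action_size (wtP (f i)); exists m.
exists (\sum_i w i); last by apply: leq_sum => i _; case: (wP i).
exists n, (fun i => existT _ (src (f i)) (existT _ (Some (dst (f i))) (Arrow i))).
exists w; split=> //; last by move=> i; case: (wP i).
exists (fun a : arrows system_diagram =>
  match projT2 (projT2 a) with Arrow i => i end) => //.
by case=> X [Y] /= a; case: a.
Qed.

End System.

(* All the sets are subsets of space-time.  [Pos n] is the singleton of [(0, n)],
   [Beyond] the part of row 0 after the input, and [Window l m r] the set of the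
   points at which the pattern [l m r] begins.  [Test (Some (Some b))],
   [Test (Some None)] and [Test None] are the points with content the bit [b], a
   blank, and anything but a blank; [Out] are the same tests in accepting rows,
   shifted to undo the border, with [Out None] marking the end of the output. *)
Inductive node {S : Type} :=
| Pos of nat | Beyond | Full | Empty
| Cell of S | Window of S & S & S
| AcceptTime | AcceptRow
| Test of option (option bool) | Out of option bool | Result.
Arguments node : clear implicits.

Inductive fixed_arrow {S : Type} :=
| Origin | BeyondStart | BeyondStep | FullArrow | EmptyArrow
| BlankRow | LeftBorder | CellEmpty of S
| WindowLeft of S & S & S | WindowMid of S & S & S | WindowRight of S & S & S
| Step of S & S & S
| AcceptCell of S | AcceptSpread
| TestCell of option (option bool) & S
| OutRow of option bool | OutTest of option bool | OutEnd
| WriteBit of bool | WriteEnd of bool.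
Arguments fixed_arrow : clear implicits.

Inductive ca_arrow {S : Type} {N : nat} :=
| PosStep of 'I_N | PosRead of 'I_N | Fixed of fixed_arrow S.
Arguments ca_arrow : clear implicits.

Definition origin (_ : unit) : point := pt 0 0.
Definition right1 (z : point) : point := pt (z ord0) (z ord_max).+1.
Definition right2 (z : point) : point := pt (z ord0) (z ord_max).+2.
Definition later (z : point) : point := pt (z ord0).+1 (z ord_max).
Definition later_right (z : point) : point := pt (z ord0).+1 (z ord_max).+1.
Definition border (z : point) : point := pt (z ord0) 0.
Definition written (b : bool) (z : point) : point := pt (z ord_max) b.

(** * The system of equations of a cellular automaton *)

Section Automaton.

Variables (S : finType) (delta : S -> S -> S -> S) (bnd blk : S).
Variables (acc : pred S) (test : option (option bool) -> pred S).

(** A tuple picks one of the 19 entries of [fixed_arrows] and its parameters. The number of tuples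
    does not involve the input, so it only enters the constant. *)
Definition ca_params : finType :=
  ('I_19 * (S * S * S) * option (option bool) * bool)%type.

Section Row.

Variables (N : nat) (row : nat -> S).

Local Notation arr := (ca_arrow S N).

(* [CellEmpty] and the arrows from [Empty] contribute nothing; they make sure that
   every union has at least one arrow, since a set without any is unconstrained. *)
Definition ca_src (a : arr) : option (node S) :=
  match a with
  | PosStep i => Some (Pos i)
  | PosRead i => Some (Pos i)
  | Fixed f =>
    match f with
    | Origin | FullArrow => None
    | BeyondStart => Some (Pos N)
    | BeyondStep | BlankRow => Some Beyond
    | EmptyArrow => Some (Pos 0)
    | LeftBorder => Some Full
    | CellEmpty _ => Some Empty
    | WindowLeft l m r => Some (Cell l)
    | WindowMid l m r => Some (Cell m)
    | WindowRight l m r => Some (Cell r)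
    | Step l m r => Some (Window l m r)
    | AcceptCell s => Some (if acc s then Cell s else Empty)
    | AcceptSpread => Some AcceptTime
    | TestCell o s => Some (if test o s then Cell s else Empty)
    | OutRow _ => Some AcceptRow
    | OutTest o => Some (Test (Some o))
    | OutEnd => Some (Test None)
    | WriteBit b => Some (Out (Some b))
    | WriteEnd _ => Some (Out None)
    end
  end.

Definition ca_dst (a : arr) : node S :=
  match a with
  | PosStep i => Pos i.+1
  | PosRead i => Cell (row i)
  | Fixed f =>
    match f with
    | Origin => Pos 0
    | BeyondStart | BeyondStep => Beyond
    | FullArrow => Full
    | EmptyArrow => Empty
    | BlankRow => Cell blk
    | LeftBorder => Cell bnd
    | CellEmpty s => Cell s
    | WindowLeft l m r | WindowMid l m r | WindowRight l m r => Window l m r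
    | Step l m r => Cell (delta l m r)
    | AcceptCell _ => AcceptTime
    | AcceptSpread => AcceptRow
    | TestCell o _ => Test o
    | OutRow o | OutTest o => Out o
    | OutEnd => Out None
    | WriteBit _ | WriteEnd _ => Result
    end
  end.

Definition ca_link (a : arr) : link (car (ca_src a)) point :=
  match a as a0 return link (car (ca_src a0)) point with
  | PosStep _ => Image right1
  | PosRead _ => Image (fun z : point => z)
  | Fixed f =>
    match f as f0 return link (car (ca_src (Fixed f0))) point with
    | Origin => Image origin
    | FullArrow => Preimage (fun=> tt)
    | BeyondStep => Image right1
    | EmptyArrow => Preimage later
    | LeftBorder => Image border
    | WindowMid _ _ _ => Preimage right1
    | WindowRight _ _ _ => Preimage right2
    | Step _ _ _ => Image later_right
    | AcceptCell _ => Image border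
    | AcceptSpread => Preimage border
    | OutTest _ => Preimage right1
    | WriteBit b | WriteEnd b => Image (written b)
    | _ => Image (fun z : point => z)
    end
  end.

Definition ca_union (w : node S) : bool :=
  match w with Window _ _ _ | Out _ => false | _ => true end.

(** A pairing costs 1, a coordinate 1 and a successor 2 more, so [right1] has size at most 1 + 1 + 3
    = 5; 7 bounds the expressions of all fixed maps. *)
Definition ca_weight (a : arr) : nat :=
  match a with PosStep _ => 5 | PosRead _ => 1 | Fixed _ => 7 end.

Lemma ca_link_expr a : link_expr nat_maps (ca_link a) (ca_weight a).
Proof.
have id1 := @expr_id nat_maps point.
have t1 := @expr_coord nat_maps ord0.
have j1 := @expr_coord nat_maps ord_max.
have t3 := expr_succ t1.
have j3 := expr_succ j1.
have right5 := expr_pair t1 j3.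
have border5 := expr_pair t1 (expr_zero point).
case: a => [i|i|].
- by exists 5.
- by exists 1.
case; try by move=> *; exists 1.
- exists 7 => //; exact: expr_pair (expr_zero unit) (expr_zero unit).
- by exists 5.
- by exists 1 => //; exact/expr_basic/basic_omega.
- by exists 5 => //; exact: expr_pair t3 j1.
- by exists 5.
- by exists 5.
- by exists 7 => //; exact: expr_pair t1 (expr_succ j3).
- by exists 7 => //; exact: expr_pair t3 j3.
- by exists 5.
- by exists 5.
- by exists 5.
- case; first by exists 7 => //; exact: expr_pair j1 (expr_succ (expr_zero point)).
  by exists 5 => //; exact: expr_pair j1 (expr_zero point).
- case; first by exists 7 => //; exact: expr_pair j1 (expr_succ (expr_zero point)).
  by exists 5 => //; exact: expr_pair j1 (expr_zero point).
Qed.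

(* Every fixed arrow occurs in one of these lists; most occur for several values
   of the parameters, which only affects the constant. *)
Definition fixed_arrows (l m r : S) (o : option (option bool)) (b : bool) :
    seq (fixed_arrow S) :=
  [:: Origin; BeyondStart; BeyondStep; FullArrow; EmptyArrow; BlankRow;
      LeftBorder; CellEmpty l; WindowLeft l m r; WindowMid l m r;
      WindowRight l m r; Step l m r; AcceptCell l; AcceptSpread;
      TestCell o l; OutRow (odflt None o); OutTest (odflt None o);
      if o is None then OutEnd else WriteBit b; WriteEnd b].

Definition ca_index : finType := ('I_N + 'I_N + ca_params)%type.

Definition ca_decode (u : ca_index) : arr :=
  match u with
  | inl (inl i) => PosStep i
  | inl (inr i) => PosRead i
  | inr (k, (l, m, r), o, b) =>
    Fixed (nth Origin (fixed_arrows l m r o b) k)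
  end.

Lemma ca_decode_onto a : exists u, ca_decode u = a.
Proof.
case: a => [i|i|f]; [by exists (inl (inl i)) | by exists (inl (inr i)) |].
pose code k l m r o b : ca_index := inr (inord k, (l, m, r), o, b).
have codeE k l m r o b : k < 19 ->
    ca_decode (code k l m r o b) = Fixed (nth Origin (fixed_arrows l m r o b) k).
  by move=> k19; rewrite /ca_decode /code inordK.
case: f.
- by exists (code 0 blk blk blk None false); rewrite codeE.
- by exists (code 1 blk blk blk None false); rewrite codeE.
- by exists (code 2 blk blk blk None false); rewrite codeE.
- by exists (code 3 blk blk blk None false); rewrite codeE.
- by exists (code 4 blk blk blk None false); rewrite codeE.
- by exists (code 5 blk blk blk None false); rewrite codeE.
- by exists (code 6 blk blk blk None false); rewrite codeE.
- by move=> s; exists (code 7 s blk blk None false); rewrite codeE.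
- by move=> l m r; exists (code 8 l m r None false); rewrite codeE.
- by move=> l m r; exists (code 9 l m r None false); rewrite codeE.
- by move=> l m r; exists (code 10 l m r None false); rewrite codeE.
- by move=> l m r; exists (code 11 l m r None false); rewrite codeE.
- by move=> s; exists (code 12 s blk blk None false); rewrite codeE.
- by exists (code 13 blk blk blk None false); rewrite codeE.
- by move=> o s; exists (code 14 s blk blk o false); rewrite codeE.
- by move=> o; exists (code 15 blk blk blk (Some o) false); rewrite codeE.
- by move=> o; exists (code 16 blk blk blk (Some o) false); rewrite codeE.
- by exists (code 17 blk blk blk None false); rewrite codeE.
- by move=> b; exists (code 17 blk blk blk (Some None) b); rewrite codeE.
- by move=> b; exists (code 18 blk blk blk None b); rewrite codeE.
Qed.

Lemma sum_ca_weight :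
  \sum_u ca_weight (ca_decode u) =
  6 * N + 7 * #|ca_params|.
Proof.
rewrite !big_sumType /= !sum_nat_const card_ord.
rewrite (eq_bigr (fun=> 7)) => [|[[[k [[l m] r]] o] b]] //.
by rewrite sum_nat_const -mulnDr mulnC [7 * _]mulnC.
Qed.

(** * The space-time pattern of the automaton solves the system *)

Variable x : nat -> nat -> S.
Hypothesis x_border : forall t, x t 0 = bnd.
Hypothesis x_row : forall j, j < N -> x 0 j = row j.
Hypothesis x_blank : forall j, N <= j -> x 0 j = blk.
Hypothesis x_step : forall t j,
  x t.+1 j.+1 = delta (x t j) (x t j.+1) (x t j.+2).

Definition accepts (t : nat) : Prop := exists j, acc (x t j).

Definition ca_node (w : node S) : set point :=
  match w with
  | Pos n => [set pt 0 n]
  | Beyond => [set z | z ord0 = 0 /\ N <= z ord_max]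
  | Full => setT
  | Empty => set0
  | Cell s => [set z | x (z ord0) (z ord_max) = s]
  | Window l m r => [set z | [/\ x (z ord0) (z ord_max) = l,
      x (z ord0) (z ord_max).+1 = m & x (z ord0) (z ord_max).+2 = r]]
  | AcceptTime => [set z | z ord_max = 0 /\ accepts (z ord0)]
  | AcceptRow => [set z | accepts (z ord0)]
  | Test o => [set z | test o (x (z ord0) (z ord_max))]
  | Out o => [set z | [/\ accepts (z ord0), test (Some o) (x (z ord0) (z ord_max).+1)
      & o = None -> test None (x (z ord0) (z ord_max))]]
  | Result => [set z | exists t i (b : bool), [/\ z = pt i b, accepts t &
      test (Some (Some b)) (x t i.+1) \/
      test (Some None) (x t i.+1) /\ test None (x t i)]]
  end.

Definition ca_section (v : option (node S)) : set (car v) :=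
  match v with None => setT | Some w => ca_node w end.

Lemma ca_node_union w y : constrained ca_dst (Some w) -> ca_union w ->
  ca_node w y ->
  exists a, ca_dst a = w /\ link_act (ca_link a) (ca_section (v := ca_src a)) y.
Proof.
case: w => [n|||| s|//||| o|//|] /= cw _.
- move=> ->; case: n cw => [|n] cw.
    by exists (Fixed Origin); split=> //; exists tt.
  (* [Pos] beyond index [N] has no incoming arrow; being constrained bounds the index. *)
  have nN : n < N by case: cw => -[i|i|[]] //= [<-].
  by exists (PosStep (Ordinal nN)); split=> //; exists (pt 0 n).
- case=> y0; rewrite leq_eqVlt => /predU1P[yN|Ny].
    exists (Fixed BeyondStart); split=> //; exists y => //=.
    by rewrite -[LHS]pt_eta y0 yN.
  exists (Fixed BeyondStep); split=> //; exists (pt 0 (y ord_max).-1).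
    by rewrite /= pt_snd -ltnS (ltn_predK Ny).
  by rewrite /right1 pt_fst pt_snd (ltn_predK Ny) -[RHS]pt_eta y0.
- by exists (Fixed FullArrow).
- by [].
(* A content has four possible causes: the input row, the blank rest of row 0, the border column,
   the transition rule. *)
- rewrite -[y]pt_eta pt_fst pt_snd; move: (y ord0) (y ord_max) => t j xs.
  case: t xs => [|t] xs.
    case: (ltnP j N) => [jN|Nj].
      exists (PosRead (Ordinal jN)); split; first by rewrite -xs x_row.
      by exists (pt 0 j).
    exists (Fixed BlankRow); split; first by rewrite -xs x_blank.
    by exists (pt 0 j).
  case: j xs => [|j] xs.
    exists (Fixed LeftBorder); split; first by rewrite -xs x_border.
    by exists (pt t.+1 0).
  exists (Fixed (Step (x t j) (x t j.+1) (x t j.+2))).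
  split; first by rewrite -xs x_step.
  by exists (pt t j).
- case=> y0 [j xj]; exists (Fixed (AcceptCell (x (y ord0) j))); split=> //=.
  by exists (pt (y ord0) j); [rewrite xj | rewrite /border pt_fst -[RHS]pt_eta y0].
- by move=> acct; exists (Fixed AcceptSpread).
- move=> ty; exists (Fixed (TestCell o (x (y ord0) (y ord_max)))); split=> //=.
  by exists y => //; rewrite ty.
- case=> t [i [b [-> acct [tb|[te tn]]]]].
    by exists (Fixed (WriteBit b)); split=> //; exists (pt t i).
  by exists (Fixed (WriteEnd b)); split=> //; exists (pt t i).
Qed.

Lemma ca_union_node a y : ca_union (ca_dst a) ->
  link_act (ca_link a) (ca_section (v := ca_src a)) y -> ca_node (ca_dst a) y.
Proof.
case: a => [i|i|] /=.
- by move=> _ [z -> <-].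
- by move=> _ [z -> <-]; rewrite /= pt_fst pt_snd x_row.
case=> //=.
- by move=> _ [z _ <-].
- by move=> _ [z -> <-].
- by move=> _ [z [z0 Nz] <-]; rewrite /= leqW.
(* [later] never reaches time 0, so the preimage of the origin is empty. *)
- by move=> _ /(congr1 (fun z : point => z ord0)).
- by move=> _ [z [z0 Nz] <-]; rewrite /= z0 x_blank.
- by move=> _ [z _ <-]; exact: x_border.
- by move=> s _ [z].
- by move=> l m r _ [z [<- <- <-] <-]; exact: x_step.
- move=> s _ [z]; case: ifP => //= accs zs <-; split=> //.
  by exists (z ord_max); rewrite /= zs.
- by move=> _ [].
- by move=> o s _ [z]; case: ifP => //= ts zs <-; rewrite zs.
- move=> b _ [z [acct tb _] <-].
  by exists (z ord0), (z ord_max), b; split=> //; left.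
- move=> b _ [z [acct tb tn] <-].
  by exists (z ord0), (z ord_max), b; split=> //; right; split=> //; exact: tn.
Qed.

Lemma ca_inter_node a y : ~~ ca_union (ca_dst a) -> ca_node (ca_dst a) y ->
  link_act (ca_link a) (ca_section (v := ca_src a)) y.
Proof.
case: a => [//|//|[]] //=.
- by move=> l m r _ [yl _ _]; exists y.
- by move=> l m r _ [_ ym _].
- by move=> l m r _ [_ _ yr].
- by move=> o _ [acct _ _]; exists y.
- by move=> o _ [_ to _].
- by move=> _ [_ _ /(_ erefl) tn]; exists y.
Qed.

Lemma ca_node_inter w y : ~~ ca_union w ->
  (forall a, ca_dst a = w ->
     link_act (ca_link a) (ca_section (v := ca_src a)) y) -> ca_node w y.
Proof.
case: w => //= [l m r|o] _ H.
  split; first by case: (H (Fixed (WindowLeft l m r)) erefl) => z zl <-.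
    exact: (H (Fixed (WindowMid l m r)) erefl).
  exact: (H (Fixed (WindowRight l m r)) erefl).
split; first by case: (H (Fixed (OutRow o)) erefl) => z acct <-.
  exact: (H (Fixed (OutTest o)) erefl).
by move=> o0; subst o; case: (H (Fixed OutEnd) erefl) => z tz <-.
Qed.

Lemma ca_solution : solution ca_union ca_dst ca_link ca_section.
Proof.
split=> // w cw; apply/predeqP => y; rewrite /rhs; case: ifP => uw /=; split.
- exact: ca_node_union.
- by case=> a [aw]; move: uw; rewrite -aw; exact: ca_union_node.
- by move=> wy a aw; move: wy; rewrite -aw; apply: ca_inter_node; rewrite aw uw.
- by apply: ca_node_inter; rewrite uw.
Qed.

(** * Well-founded dependencies and uniqueness *)

Definition ca_stage (v : option (node S)) : nat :=
  match v with
  | None => 0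
  | Some (Pos _) => 1
  | Some (Cell _) | Some (Window _ _ _) => 3
  | Some AcceptTime | Some (Test _) => 4
  | Some AcceptRow => 5
  | Some (Out _) => 6
  | Some Result => 7
  | _ => 2
  end.

(** Cells and windows refer to each other: a window at time t reads cells at time t, a cell at time
    t + 1 reads windows at time t, and 2t < 2t + 1 < 2t + 2. [Pos] descends in its index and
    [Beyond] in the column. *)
Definition ca_level (v : option (node S)) : car v -> nat :=
  match v with
  | None => fun=> 0
  | Some w => fun z : point =>
    match w with
    | Pos n => n
    | Cell _ => (z ord0).*2
    | Window _ _ _ => (z ord0).*2.+1
    | _ => z ord_max
    end
  end.

(** Every set that is read is determined: [Pos] is read only up to index [N], and [CellEmpty]
    reaches each [Cell]. *)
Lemma ca_constrained a : constrained ca_dst (ca_src a).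
Proof.
have cPos n : n <= N -> constrained ca_dst (Some (Pos n)).
  case: n => [|n] nN; first by exists (Fixed Origin).
  by exists (PosStep (Ordinal nN)).
have cCell s : constrained ca_dst (Some (Cell s)) by exists (Fixed (CellEmpty s)).
have cIf (b : bool) s : constrained ca_dst (Some (if b then Cell s else Empty)).
  by case: b; [exact: cCell | exists (Fixed EmptyArrow)].
case: a => [i|i|]; try by apply: cPos; exact: ltnW.
case.
- by [].
- exact: cPos.
- by exists (Fixed BeyondStart).
- by [].
- exact: cPos.
- by exists (Fixed BeyondStart).
- by exists (Fixed FullArrow).
- by move=> s; exact: (cIf false).
- by move=> l m r; exact: cCell.
- by move=> l m r; exact: cCell.
- by move=> l m r; exact: cCell.
- by move=> l m r; exists (Fixed (WindowLeft l m r)).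
- by move=> s; exact: cIf.
- by exists (Fixed (AcceptCell blk)).
- by move=> o s; exact: cIf.
- by move=> o; exists (Fixed AcceptSpread).
- by move=> o; exists (Fixed (TestCell (Some o) blk)).
- by exists (Fixed (TestCell None blk)).
- by move=> b; exists (Fixed (OutRow (Some b))).
- by move=> b; exists (Fixed OutEnd).
Qed.

Lemma ca_decr a p q : link_rel (ca_link a) p q ->
  ca_stage (ca_src a) < ca_stage (Some (ca_dst a)) \/
  ca_stage (ca_src a) = ca_stage (Some (ca_dst a)) /\
  ca_level p < @ca_level (Some (ca_dst a)) q.
Proof.
case: a p q => [i|i|]; [by right | by left |].
case; try by left.
- by move=> p q <-; right.
- by move=> l m r p q ->; right.
- by move=> l m r p q ->; right.
- by move=> l m r p q ->; right.
- by move=> l m r p q <-; right; rewrite /= doubleS.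
- by move=> s p q _; left=> /=; case: ifP.
- by move=> o s p q _; left=> /=; case: ifP.
Qed.

Lemma ca_represents :
  exists k, (exists (D : diagram) (one v : member D),
      represents one v (ca_node Result) /\ diagram_size nat_maps D k) /\
    k <= 6 * N + 7 * #|ca_params|.
Proof.
pose f (i : 'I_#|ca_index|) := ca_decode (enum_val i).
have f_onto a : exists i, f i = a.
  by have [u <-] := ca_decode_onto a; exists (enum_rank u); rewrite /f enum_rankK.
have [k kD kle] := system_diagram_size ca_union ca_dst f ca_link_expr.
exists k; split; last first.
  rewrite -sum_ca_weight (leq_trans kle) //; apply/eq_leq.
  by rewrite -(big_enum_val (fun u => ca_weight (ca_decode u))).
exists (system_diagram ca_union ca_dst ca_link f), None, (Some Result); split=> //.
have sec := pointed_sectionsE ca_union ca_dst ca_link f_onto.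
(* The intended solution shows that a section exists; by uniqueness every section agrees with it on
   [Result]. *)
split=> //; first by exists ca_section; exact/sec/ca_solution.
move=> s /sec ss; congr existT.
apply: (solution_unique ca_constrained ca_decr ss ca_solution (v := Some Result)).
by exists (Fixed (WriteEnd true)).
Qed.

End Row.
End Automaton.

(** * Turing machines as cellular automata *)

Section Machine.

Variable U : turing_machine.

(* [None] is the border to the left of cell 0; the first component of a cell is
   the state of the machine if the head is there. *)
Definition cell : finType := option (option (tm_state U) * tm_symbol U).

Definition halted (q : tm_state U) : bool :=
  (q == tm_accept U) || (q == tm_reject U).

Definition emit (c : cell) : option (tm_state U * tm_symbol U * bool) :=
  if c is Some (Some q, a) then if halted q then None else Some (tm_trans q a)
  else None.

(** An acting cell loses its head, except on a left move next to the border, where the head stays.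
    Any other cell may receive a head from a neighbour; failing that it is unchanged, which
    preserves halted heads. *)
Definition cell_next (l m r : cell) : cell :=
  match m with
  | None => None
  | Some (h, a) =>
    Some (match emit m with
          | Some (q, a', d) =>
            (if ~~ d && (l == None) then Some q else None, a')
          | None =>
            (match emit l, emit r with
             | Some (q, _, true), _ => Some q
             | _, Some (q, _, false) => Some q
             | _, _ => h
             end, a)
          end)
  end.

Definition cell_at (c : tm_config U) (j : nat) : cell :=
  if j is i.+1 then
    Some (if tm_head c == i then Some (tm_control c) else None, tm_tape c i)
  else None.

Definition cell_accept (c : cell) : bool :=
  if c is Some (Some q, _) then q == tm_accept U else false.

(** The border counts as nonblank, so that the end of an empty output is found too. *)
Definition cell_test (o : option (option bool)) (c : cell) : bool :=
  match o with
  | Some (Some b) => if c is Some (_, a) then a == tm_bit U b else false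
  | Some None => if c is Some (_, a) then a == tm_blank U else false
  | None => if c is Some (_, a) then a != tm_blank U else true
  end.

Definition tm_run (p : seq bool) (t : nat) : tm_config U :=
  iter t (@tm_step U) (tm_init U p).

Lemma cell_at_step c j :
  cell_at (tm_step c) j.+1 =
  cell_next (cell_at c j) (cell_at c j.+1) (cell_at c j.+2).
Proof.
case: c => q h t; rewrite /tm_step -/(halted q).
have emitE i : emit (cell_at (TMConfig q h t) i.+1) =
    if h == i then if halted q then None else Some (tm_trans q (t h)) else None.
  by rewrite /emit /=; case: eqP => // ->.
have emitL : emit (cell_at (TMConfig q h t) j) =
    if h.+1 == j then if halted q then None else Some (tm_trans q (t h)) else None.
  by case: j => [|j]; rewrite ?emitE.
rewrite [in RHS]/cell_next [in RHS]/(cell_at _ j.+1) -/(cell_at _ j.+1).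
rewrite !emitE emitL /=; case hq: (halted q); first by rewrite !if_same.
case: (tm_trans q (t h)) => [[q' a] d] /=; rewrite [j == h]eq_sym.
case: (eqVneq h j) => [->|hj].
  case: d; first by rewrite gtn_eqF.
  by case: j {emitL} => [|j] //=; rewrite ltn_eqF.
case: d; first by case: eqP => // _; case: eqP.
(* As the head is not at [j], a left move blocked at cell 0 does not end there. *)
have -> : (h.-1 == j) = (h == j.+1).
  by case: h hj {emitE emitL} => // hj; rewrite (negbTE hj).
by case: (eqVneq h j.+1) => [->|_]; [rewrite gtn_eqF | case: eqP].
Qed.

(** Accepting configurations are fixed by [tm_step], so reading all accepting rows at once is
    harmless. *)
Lemma tm_run_accept p t t' :
  tm_control (tm_run p t) = tm_accept U ->
  tm_control (tm_run p t') = tm_accept U -> tm_run p t = tm_run p t'.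
Proof.
have H n m : n <= m -> tm_control (tm_run p n) = tm_accept U ->
    tm_run p n = tm_run p m.
  move=> nm acc; rewrite -(subnK nm) /tm_run iterD -/(tm_run p n).
  elim: (m - n) => //= k <-.
  by move: acc; case: (tm_run p n) => q h tp /= ->; rewrite eqxx.
by case: (leqP t t') => [tt'|/ltnW t't] acc acc'; [exact: H | symmetry; exact: H].
Qed.

Lemma accepts_run p t :
  accepts cell_accept (fun t => cell_at (tm_run p t)) t <->
  tm_control (tm_run p t) = tm_accept U.
Proof.
split=> [[[|j]] //=|acct]; first by case: eqP => // _ /eqP.
by exists (tm_head (tm_run p t)).+1; rewrite /= eqxx /= acct.
Qed.

Lemma result_string p sigma : tm_outputs U p sigma ->
  ca_node cell_accept cell_test (size p).+2 (fun t => cell_at (tm_run p t))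
    Result = string_set sigma.
Proof.
case=> n [accn tapen].
have bitE i b : (tm_string_tape U sigma i == tm_bit U b) =
    (i < size sigma) && (nth false sigma i == b).
  rewrite /tm_string_tape; case: ltnP => [lti|lei] /=.
    by rewrite (nth_map false) // (inj_eq (@tm_bit_inj U)).
  by rewrite nth_default ?size_map // eq_sym (negbTE (tm_bit_blank U b)).
have blankE i : (tm_string_tape U sigma i == tm_blank U) = (size sigma <= i).
  rewrite /tm_string_tape; case: leqP => [lei|lti].
    by rewrite nth_default ?size_map // eqxx.
  by rewrite (nth_map false) // (negbTE (tm_bit_blank U _)).
have run_tape t i : tm_control (tm_run p t) = tm_accept U ->
    tm_tape (tm_run p t) i = tm_string_tape U sigma i.
  by move=> acct; rewrite (tm_run_accept acct accn) tapen.
apply/predeqP => z; split.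
  case=> t [i [b [-> /accepts_run acct]]] /=.
  rewrite !run_tape // bitE blankE => -[/andP[lti /eqP <-]|[lei nb]].
    by left; exists i.
  (* A blank right after a bit or the border can only sit at the end of the output. *)
  have -> : i = size sigma.
    apply/eqP; rewrite eqn_leq lei andbT.
    by case: i nb {lei} => //= i; rewrite run_tape // blankE -ltnNge.
  by right; case: b; [right | left].
have acct : accepts cell_accept (fun t => cell_at (tm_run p t)) n.
  exact/accepts_run.
have last : cell_test (Some None) (cell_at (tm_run p n) (size sigma).+1) /\
    cell_test None (cell_at (tm_run p n) (size sigma)).
  rewrite /= run_tape // blankE leqnn; split=> //.
  by case: (size sigma) (blankE) => //= m bE; rewrite run_tape // bE ltnn.
case=> [[i lti <-]|[->|->]].
- exists n, i, (nth false sigma i); split=> //; left.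
  by rewrite /= run_tape // bitE lti /=.
- by exists n, (size sigma), false; split=> //; right.
- by exists n, (size sigma), true; split=> //; right.
Qed.

Lemma structural_information_le p sigma : tm_outputs U p sigma ->
  le_inf (structural_information nat_maps (string_set sigma))
    (Some (6 * size p + (12 + 7 * #|ca_params cell|))).
Proof.
(* Of the two cells beyond [size p], one is the border and one makes room for the head on empty
   input; they cost 12. *)
move=> psigma; have [] := @ca_represents cell cell_next None
  (Some (None, tm_blank U)) cell_accept cell_test (size p).+2
  (cell_at (tm_run p 0)) (fun t => cell_at (tm_run p t)).
- by [].
- by [].
- case=> // -[|i] //; rewrite ltnS => lei; rewrite /= /tm_string_tape.
  by rewrite nth_default // size_map ltnW.
- by move=> t j; rewrite /tm_run iterS cell_at_step.
rewrite (result_string psigma) => k [kD kle].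
rewrite /structural_information.
have [m -> mk] := min_nat_le (P := [set k | exists (D : diagram) (one x : member D),
  represents one x (string_set sigma) /\ diagram_size nat_maps D k]) kD.
rewrite /= (leq_trans mk) // (leq_trans kle) // addnA leq_add2r.
by rewrite !mulnS addnA addnC.
Qed.

End Machine.

Theorem theorem2 (U : turing_machine) (HU : universal U) :
  exists c : nat, forall sigma : seq bool,
    le_inf (structural_information nat_maps (string_set sigma))
           (omap (fun k => 6 * k + c) (kolmogorov U sigma)).
Proof.
exists (12 + 7 * #|ca_params (cell U)|) => sigma.
case E : (kolmogorov U sigma) => [k|]; last by case: structural_information.
by case/min_natP: E => -[p [<- psigma]] _; exact: structural_information_le.
Qed.
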